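(* Fix $\lambda,\eta>0$ and $m>1$, and let $\Psi:\mathbb{R}^d\to[0,\infty)$ be in $W^{1,1}_{\mathrm{loc}}(\mathbb{R}^d)$. For any $C\in\mathbb{R}$, the function $U(\cdot;C):\mathbb{R}^d\to(0,\infty)$, $U(y;C):=h^{-1}(C-\Psi(y))$, where $h(z):=\lambda\ln z+\frac{\eta m}{m-1}(z^{m-1}-1)$ for $z>0$, is the unique positive solution $\rho$ to $$\lambda\ln\rho(y)+\frac{\eta m}{m-1}\rho^{m-1}(y)=\Big(\frac{\eta m}{m-1}+C\Big)-\Psi(y),\quad y\in\mathbb{R}^d,$$ and it has the explicit formula $$U(y;C)=\left(\frac{\lambda}{\eta m}\mathbf{W_0}\left(\frac{\eta m}{\lambda}e^{-\frac{m-1}{\lambda}\left\{\Psi(y)-\left(\frac{\eta m}{m-1}+C\right)\right\}}\right)\right)^{\frac1{m-1}},\quad y\in\mathbb{R}^d.$$ If there are $R,\delta>0$ such that $\Psi(y)\ge(\lambda d+\delta)\ln|y|$ for all $|y|\ge R$, then $U(\cdot;C)\in L^k(\mathbb{R}^d)$ for all $k\ge1$. Moreover, if there are $R,\delta>0$ such that $\Psi(y)\ge(\lambda(d+2)+\delta)\ln|y|$ for all $|y|\ge R$, then additionally $\int_{\mathbb{R}^d}|y|^2U(y;C)\,dy<\infty$.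
   Context: $h$ is a strictly increasing bijection from $(0,\infty)$ onto $\mathbb{R}$, so $h^{-1}$ is well-defined. $\mathbf{W_0}:[0,\infty)\to[0,\infty)$ is the inverse function of $y\mapsto ye^y$ on $[0,\infty)$ (principal branch of the Lambert W function). *)

(* Defs.v *)
From HB Require Import structures.
From mathcomp Require Import all_boot all_order all_algebra.
From mathcomp Require Import all_classical all_reals all_analysis.

Set Implicit Arguments.
Unset Strict Implicit.
Unset Printing Implicit Defensive.

Import Order.TTheory GRing.Theory Num.Theory.
Import numFieldNormedType.Exports.

Local Open Scope classical_set_scope.
Local Open Scope ring_scope.

Definition measure_rV_display : measure_display -> measure_display.
Proof. exact. Qed.

(* Row vectors carry the sigma-algebra generated by the coordinate maps; over
   the reals this is the Borel sigma-algebra of 'rV[R]_n. *)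
Section measurable_rV.
Context {disp : measure_display} {T : sigmaRingType disp}.
Variable n : nat.

Let coord : 'I_n -> 'rV[T]_n -> T := fun i v => v ord0 i.

Let rV_set0 : g_sigma_preimage coord set0.
Proof. exact: sigma_algebra0. Qed.

Let rV_setC A : g_sigma_preimage coord A -> g_sigma_preimage coord (~` A).
Proof. exact: sigma_algebraC. Qed.

Let rV_bigcup (F : _^nat) : (forall i, g_sigma_preimage coord (F i)) ->
  g_sigma_preimage coord (\bigcup_i (F i)).
Proof. exact: sigma_algebra_bigcup. Qed.

HB.instance Definition _ := @isMeasurable.Build (measure_rV_display disp)
  'rV[T]_n (g_sigma_preimage coord) rV_set0 rV_setC rV_bigcup.

End measurable_rV.

Section coordinates.
Context d1 d2 (T1 : measurableType d1) (T2 : measurableType d2).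

Lemma measurable_coord n (i : 'I_n) :
  measurable_fun [set: 'rV[T2]_n] (fun v => v ord0 i).
Proof.
move=> _ Y mY; rewrite setTI; apply: sub_sigma_algebra => /=.
rewrite -bigcup_seq/=; exists i => /=; first by rewrite mem_index_enum.
by exists Y => //; rewrite setTI.
Qed.

Lemma measurable_fun_rVP n (f : T1 -> 'rV[T2]_n) :
  (forall i, measurable_fun [set: T1] (fun x => f x ord0 i)) ->
  measurable_fun [set: T1] f.
Proof.
move=> mf; apply: (@measurability _ _ _ 'rV[T2]_n _ _
  (\big[setU/set0]_(i < n) preimage_set_system setT
     (fun v : 'rV[T2]_n => v ord0 i) measurable)) => //.
move=> _ [B + <-]; rewrite -bigcup_seq => -[i _ [A mA <-]].
by have := mf i measurableT A mA; rewrite !setTI.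
Qed.

End coordinates.

Section lebesgue_rV.
Context {R : realType}.
Local Open Scope ereal_scope.

Definition rV_cons n (p : R * 'rV[R]_n) : 'rV[R]_n.+1 :=
  row_mx (p.1)%:M p.2.

Definition rV_uncons n (v : 'rV[R]_n.+1) : R * 'rV[R]_n :=
  (v ord0 ord0, \row_i v ord0 (lift ord0 i)).

Lemma rV_cons0 n (p : R * 'rV[R]_n) : rV_cons p ord0 ord0 = p.1.
Proof.
transitivity (rV_cons p ord0 (@lshift 1 n ord0)).
  by congr (rV_cons p ord0 _); exact/val_inj.
by rewrite [LHS](row_mxEl (p.1)%:M p.2) mxE eqxx mulr1n.
Qed.

Lemma rV_consS n (p : R * 'rV[R]_n) (i : 'I_n) :
  rV_cons p ord0 (lift ord0 i) = p.2 ord0 i.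
Proof.
transitivity (rV_cons p ord0 (@rshift 1 n i)).
  by congr (rV_cons p ord0 _); exact/val_inj.
exact: (row_mxEr (p.1)%:M p.2).
Qed.

Lemma rV_consK n : cancel (@rV_cons n) (@rV_uncons n).
Proof.
move=> [x v]; rewrite /rV_uncons rV_cons0; congr pair.
by apply/rowP => i; rewrite mxE rV_consS.
Qed.

Lemma measurable_rV_cons n :
  measurable_fun [set: R * 'rV[R]_n] (@rV_cons n).
Proof.
apply: measurable_fun_rVP => i; have [j ->|->] := unliftP ord0 i.
  under eq_fun do rewrite rV_consS.
  exact: (measurableT_comp (measurable_coord j) measurable_snd).
by under eq_fun do rewrite rV_cons0; exact: measurable_fst.
Qed.

Lemma measurable_rV_uncons n :
  measurable_fun [set: 'rV[R]_n.+1] (@rV_uncons n).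
Proof.
apply: measurable_fun_pair; first exact: measurable_coord.
apply: measurable_fun_rVP => i; under eq_fun do rewrite mxE.
exact: measurable_coord.
Qed.

Section step.
Variables (n : nat) (mu : {sigma_finite_measure set 'rV[R]_n -> \bar R}).

Definition lebesgue_rV_cons : set 'rV[R]_n.+1 -> \bar R :=
  pushforward (lebesgue_measure \x mu) (@rV_cons n).

Let lebesgue_rV_cons0 : lebesgue_rV_cons set0 = 0.
Proof. by rewrite /lebesgue_rV_cons /pushforward preimage_set0 measure0. Qed.

Let lebesgue_rV_cons_ge0 A : 0 <= lebesgue_rV_cons A.
Proof. by apply: integral_ge0 => x _; exact: measure_ge0. Qed.

Let lebesgue_rV_cons_sigma_additive : semi_sigma_additive lebesgue_rV_cons.
Proof.
move=> F mF tF mUF; rewrite /lebesgue_rV_cons /pushforward preimage_bigcup.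
apply: measure_semi_sigma_additive.
- by move=> k; rewrite -[X in measurable X]setTI; exact: measurable_rV_cons.
- apply/trivIsetP => /= i j _ _ ij; rewrite -preimage_setI.
  by move/trivIsetP : tF => ->//; rewrite preimage_set0.
- rewrite -preimage_bigcup -[X in measurable X]setTI.
  exact: measurable_rV_cons.
Qed.

HB.instance Definition _ := isMeasure.Build _ _ _ lebesgue_rV_cons
  lebesgue_rV_cons0 lebesgue_rV_cons_ge0 lebesgue_rV_cons_sigma_additive.

Let lebesgue_rV_cons_sigma_finite : sigma_finite setT lebesgue_rV_cons.
Proof.
have /sigma_finiteP[F [TF ndF Foo]] := sigma_finiteT (@lebesgue_measure R).
have /sigma_finiteP[G [TG ndG Goo]] := sigma_finiteT mu.
exists (fun k => @rV_uncons n @^-1` (F k `*` G k)).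
  rewrite -preimage_bigcup (_ : \bigcup_k _ = setT) ?preimage_setT//.
  apply/seteqP; split => // -[x v] _.
  have [i _ Fix] : (\bigcup_i F i) x by rewrite -TF.
  have [j _ Gjv] : (\bigcup_i G i) v by rewrite -TG.
  exists (maxn i j) => //; split.
  - by move: x Fix; exact/subsetPset/ndF/leq_maxl.
  - by move: v Gjv; exact/subsetPset/ndG/leq_maxr.
move=> k; have [mF Fk] := Foo k; have [mG Gk] := Goo k; split.
  rewrite -[X in measurable X]setTI.
  by apply: measurable_rV_uncons => //; exact: measurableX.
rewrite /lebesgue_rV_cons /pushforward -comp_preimage.
rewrite (_ : _ \o _ = id); last by apply/funext => p; exact: rV_consK.
by rewrite product_measure1E// lte_mul_pinfty// ge0_fin_numE.
Qed.

HB.instance Definition _ := Measure_isSigmaFinite.Build _ _ _ lebesgue_rV_cons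
  lebesgue_rV_cons_sigma_finite.

End step.

(* Lebesgue measure on the Borel sets of R^n, as an n-fold product; R^0 is a
   point of mass 1. *)
Fixpoint borel_lebesgue_rV n : {sigma_finite_measure set 'rV[R]_n -> \bar R} :=
  match n with
  | 0 => \d_ (0 : 'rV[R]_0)%R
  | n'.+1 => lebesgue_rV_cons (borel_lebesgue_rV n')
  end.

Lemma borel_lebesgue_rV_box n (a b : 'rV[R]_n) :
  (forall i, a ord0 i <= b ord0 i)%R ->
  borel_lebesgue_rV n [set v | forall i, v ord0 i \in `[a ord0 i, b ord0 i]%R]
  = (\prod_(i < n) (b ord0 i - a ord0 i))%:E.
Proof.
elim: n a b => [|n IHn] a b ab.
  by rewrite big_ord0 /= diracE mem_set//= => -[].
pose a' : 'rV[R]_n := \row_i a ord0 (lift ord0 i).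
pose b' : 'rV[R]_n := \row_i b ord0 (lift ord0 i).
pose B' := [set v : 'rV[R]_n | forall i, v ord0 i \in `[a' ord0 i, b' ord0 i]%R].
rewrite big_ord_recl /= /lebesgue_rV_cons /pushforward.
rewrite [X in (_ \x _) X](_ : _ = `[a ord0 ord0, b ord0 ord0] `*` B');
    last first.
  apply/seteqP; split => -[x v] /=.
    move=> H; split; first by have := H ord0; rewrite rV_cons0.
    by move=> i; have := H (lift ord0 i); rewrite rV_consS !mxE.
  move=> [H0 HS] i; have [j ->|->] := unliftP ord0 i.
    by have := HS j; rewrite rV_consS !mxE.
  by rewrite rV_cons0.
have mB' : measurable B'.
  rewrite (_ : B' = \bigcap_(i in [set: 'I_n])
      ((fun v : 'rV[R]_n => v ord0 i) @^-1` `[a' ord0 i, b' ord0 i])).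
    apply: fin_bigcap_measurable => // i _.
    by rewrite -[X in measurable X]setTI; exact: measurable_coord.
  by apply/seteqP; split => v /= H i; [move=> _; exact: H|exact: H].
rewrite product_measure1E// IHn => [|i]; last by rewrite !mxE.
rewrite EFinM; congr (_ * _); last first.
  by congr (_%:E); apply: eq_bigr => i _; rewrite !mxE.
rewrite [LHS]lebesgue_measure_itv /= lte_fin.
case: ifPn => //; rewrite -leNgt => ba.
have /eqP -> : a ord0 ord0 == b ord0 ord0 by rewrite eq_le ab.
by rewrite subrr.
Qed.

End lebesgue_rV.

(* Complete Lebesgue measure: the outer measure induced by borel_lebesgue_rV,
   restricted to its Caratheodory-measurable sets, which are the
   Lebesgue-measurable sets of R^d. *)
Definition lebesgue_rV_type (R : realType) (d : nat) :=
  caratheodory_type ((borel_lebesgue_rV d : {measure set 'rV[R]_d -> \bar R})^*)%mu.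

Definition lebesgue_rV (R : realType) (d : nat) :
    {measure set (lebesgue_rV_type R d) -> \bar R} :=
  @completed_measure_extension _ _ _ (@borel_lebesgue_rV R d).

(* The library norm on 'rV[R]_d is the sup norm. *)
Definition euclidean_norm (R : realType) (d : nat) (y : 'rV[R]_d) : R :=
  Num.sqrt (\sum_(i < d) y ord0 i ^+ 2).

Section sobolev.
Context {R : realType} {d : nat}.
Implicit Types f g phi : 'rV[R]_d -> R.

Definition partial (i : 'I_d) f : 'rV[R]_d -> R :=
  'D_(delta_mx ord0 i : 'rV[R]_d) f.

Definition smooth f := forall s : seq 'I_d,
  let g := foldr partial f s in
  continuous g /\ forall x i, derivable g x (delta_mx ord0 i).

Definition test_function phi :=
  smooth phi /\ compact (closure [set x | phi x != 0]).

Definition L1loc f := forall K : set 'rV[R]_d, compact K ->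
  (lebesgue_rV R d).-integrable K (EFin \o f).

Definition weak_partial (i : 'I_d) f g := forall phi, test_function phi ->
  (\int[lebesgue_rV R d]_x (f x * partial i phi x) =
   - \int[lebesgue_rV R d]_x (g x * phi x))%R.

Definition W11loc f :=
  L1loc f /\ forall i, exists2 g, L1loc g & weak_partial i f g.

End sobolev.

Section lambert.
Context {R : realType}.

(* 'pinv_dflt A f inverts f on A and takes junk values off f @` A.  For
   lambda, eta > 0 and m > 1 the functions below are bijections from
   [0, +oo[ onto [0, +oo[ and from ]0, +oo[ onto R, respectively. *)

Definition lambertW0 : R -> R :=
  'pinv_(fun=> 0) `[0, +oo[ (fun y : R => y * expR y).

Definition h (lambda eta m z : R) : R :=
  lambda * ln z + eta * m / (m - 1) * (z `^ (m - 1) - 1).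

Definition h_inv (lambda eta m : R) : R -> R :=
  'pinv_(fun=> 1) `]0, +oo[ (h lambda eta m).

Definition U (d : nat) (lambda eta m : R) (Psi : 'rV[R]_d -> R) (C : R)
    (y : 'rV[R]_d) : R :=
  h_inv lambda eta m (C - Psi y).

End lambert.

(* Main.v *)
(* In the variable t = ln z, h is a continuous increasing function of t that
   dominates lambda t - eta m / (m - 1); hence h is a bijection onto R and
   h_inv c <= A exp(c / lambda).  Setting w = (eta m / lambda) z^(m-1), the
   equation h z = c exponentiates to an equation of the form w e^w = b, which W_0
   solves.  The growth of Psi turns the exponential bound into
   U(y) <= A |y|^-(d+eps), resp. |y|^2 U(y) <= A |y|^-(d+eps), away from the
   origin, and such a decay is integrable by summing over dyadic cubes. *)
Require Import Defs.
From HB Require Import structures.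
From mathcomp Require Import all_boot all_order all_algebra.
From mathcomp Require Import all_classical all_reals all_analysis.
From mathcomp Require Import measurable_realfun ring.

Set Implicit Arguments.
Unset Strict Implicit.
Unset Printing Implicit Defensive.

Import Order.TTheory GRing.Theory Num.Theory.
Import numFieldNormedType.Exports.

Local Open Scope classical_set_scope.
Local Open Scope ring_scope.

(** * Inversion of [h] and the Lambert formula *)

Section entropy.
Context {R : realType}.
Variables lambda eta m : R.
Hypotheses (hlambda : 0 < lambda) (heta : 0 < eta) (hm : 1 < m).

Let K_gt0 : 0 < eta * m / (m - 1).
Proof. by rewrite divr_gt0 ?subr_gt0// mulr_gt0// (lt_trans ltr01). Qed.

Lemma lt_h (x y : R) : 0 < x -> x < y -> h lambda eta m x < h lambda eta m y.
Proof.
move=> x0 xy; have y0 := lt_trans x0 xy; rewrite /h ltrD//.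
  by rewrite ltr_pM2l// ltr_ln.
rewrite ltr_pM2l// ltrD2r gt0_ltr_powR// ?subr_gt0//.
- by rewrite nnegrE ltW.
- by rewrite nnegrE ltW.
Qed.

Lemma h_inj (x y : R) :
  0 < x -> 0 < y -> h lambda eta m x = h lambda eta m y -> x = y.
Proof.
move=> x0 y0 e; apply/eqP; rewrite eq_le !leNgt; apply/andP; split.
- by apply/negP => /(lt_h y0); rewrite e ltxx.
- by apply/negP => /(lt_h x0); rewrite e ltxx.
Qed.

Lemma h_surj (c : R) : exists2 z, 0 < z & h lambda eta m z = c.
Proof.
pose g (t : R) := lambda * t + eta * m / (m - 1) * (expR ((m - 1) * t) - 1).
have gE t : h lambda eta m (expR t) = g t.
  by rewrite /h expRK /powR gt_eqF ?expR_gt0// expRK.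
have cg : continuous g.
  move=> t; apply: cvgD; first by apply: cvgM; [exact: cvg_cst|exact: cvg_id].
  apply: cvgM; first exact: cvg_cst.
  apply: cvgB; last exact: cvg_cst.
  apply: (@continuous_comp _ _ _ (fun t => (m - 1) * t) expR).
    by apply: cvgM; [exact: cvg_cst|exact: cvg_id].
  exact: continuous_expR.
have m1 : 0 < m - 1 by rewrite subr_gt0.
have g0 : g 0 = 0 by rewrite /g !mulr0 expR0 subrr mulr0 addr0.
suff [t _ gt] : exists2 t, true & g t = c.
  by exists (expR t); rewrite ?expR_gt0// gE.
(* The exponential term of [g] has the sign of [t], so [g (c / lambda)] lies beyond [c] as seen from
   [g 0 = 0]; the intermediate value theorem applies between 0 and [c / lambda]. *)
have [c0|c0] := leP 0 c.
- have gc : c <= g (c / lambda).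
    rewrite /g mulrC divfK ?gt_eqF// lerDl mulr_ge0 ?(ltW K_gt0)//.
    rewrite subr_ge0 -[leLHS]expR0 ler_expR mulr_ge0 ?(ltW m1)//.
    by rewrite divr_ge0 ?(ltW hlambda).
  have [|||t _ gt] := @IVT R g 0 (c / lambda) c.
  + by rewrite divr_ge0 ?(ltW hlambda).
  + exact: continuous_subspaceT.
  + by rewrite g0 ge_min c0 le_max gc orbT.
  by exists t.
- have gc : g (c / lambda) <= c.
    rewrite /g mulrC divfK ?gt_eqF// gerDl pmulr_rle0//.
    rewrite subr_le0 -[leRHS]expR0 ler_expR pmulr_rle0// pmulr_lle0 ?invr_gt0//.
    exact: ltW.
  have [|||t _ gt] := @IVT R g (c / lambda) 0 c.
  + by rewrite pmulr_lle0 ?invr_gt0// ltW.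
  + exact: continuous_subspaceT.
  + by rewrite g0 ge_min gc le_max (ltW c0) orbT.
  by exists t.
Qed.

Lemma hK (z : R) : 0 < z -> h_inv lambda eta m (h lambda eta m z) = z.
Proof.
move=> z0; rewrite /h_inv; apply: (@pinvKV _ _ (fun=> 1) `]0, +oo[).
  by move=> x y; rewrite !inE/= !in_itv/= !andbT; exact: h_inj.
by rewrite inE/= in_itv/= z0.
Qed.

(** Every [c] is some [h z] with [z > 0], so the default value of the partial inverse never
    appears. *)
Lemma h_invP (c : R) :
  0 < h_inv lambda eta m c /\ h lambda eta m (h_inv lambda eta m c) = c.
Proof. by have [z z0 <-] := h_surj c; rewrite hK. Qed.

Lemma h_inv_nondecreasing (x y : R) :
  x <= y -> h_inv lambda eta m x <= h_inv lambda eta m y.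
Proof.
move=> xy; rewrite leNgt; apply/negP.
have [x0 hx] := h_invP x; have [y0 hy] := h_invP y.
by move/(lt_h y0); rewrite hx hy ltNge xy.
Qed.

(** Dropping the nonnegative term in [z ^ (m - 1)] from [h z = c] leaves
    [lambda * ln z <= eta * m / (m - 1) + c]. *)
Lemma h_inv_le_expR (c : R) :
  h_inv lambda eta m c <= expR ((eta * m / (m - 1) + c) / lambda).
Proof.
have [z0 hz] := h_invP c; move: z0 hz.
set z := h_inv _ _ _ _ => z0 hz.
rewrite -[leLHS]lnK// ler_expR ler_pdivlMr// -hz /h mulrBr mulr1 mulrC.
by rewrite addrCA subrKC lerDl mulr_ge0 ?powR_ge0// ltW.
Qed.

Lemma lambertW0K (w : R) : 0 <= w -> lambertW0 (w * expR w) = w.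
Proof.
move=> w0; rewrite /lambertW0.
apply: (@pinvKV _ _ (fun=> 0) `[0, +oo[ (fun y : R => y * expR y)); last first.
  by rewrite inE/= in_itv/= w0.
move=> x y; rewrite !inE/= !in_itv/= !andbT => x0 y0.
have lt_mulexp (a b : R) : 0 <= a -> a < b -> a * expR a < b * expR b.
  move=> a0 ab; rewrite (@le_lt_trans _ _ (a * expR b))//.
    by rewrite ler_wpM2l// ler_expR ltW.
  by rewrite ltr_pM2r ?expR_gt0.
move=> e; apply/eqP; rewrite eq_le !leNgt; apply/andP; split.
- by apply/negP => /(lt_mulexp _ _ y0); rewrite e ltxx.
- by apply/negP => /(lt_mulexp _ _ x0); rewrite e ltxx.
Qed.

Lemma h_inv_lambert (c : R) : h_inv lambda eta m c =
  (lambda / (eta * m) * lambertW0 (eta * m / lambda *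
     expR ((m - 1) / lambda * (eta * m / (m - 1) + c)))) `^ (m - 1)^-1.
Proof.
have [z0 hz] := h_invP c; move: z0 hz.
set z := h_inv _ _ _ _ => z0 hz.
have m1 : m - 1 != 0 by rewrite subr_eq0 gt_eqF.
have l0 : lambda != 0 by rewrite gt_eqF.
have em0 : eta * m != 0.
  by rewrite mulf_neq0// gt_eqF// (lt_trans ltr01).
pose w := eta * m / lambda * z `^ (m - 1).
have w0 : 0 <= w.
  rewrite mulr_ge0 ?powR_ge0// divr_ge0 ?ltW// mulr_gt0//.
  exact: lt_trans hm.
(* Substituting [c = h z] cancels the constant, and the argument of [lambertW0] becomes
   [eta * m / lambda * z ^ (m - 1) * expR w], that is [w * expR w]. *)
have -> : (m - 1) / lambda * (eta * m / (m - 1) + c) = (m - 1) * ln z + w.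
  rewrite -hz /h /w; field.
  by rewrite l0 m1.
rewrite expRD mulrA.
have -> : expR ((m - 1) * ln z) = z `^ (m - 1) by rewrite /powR gt_eqF.
rewrite lambertW0K// /w mulrA.
rewrite mulf_div mulrC [X in _ * X](_ : _ = 1) ?mulr1; last first.
  by rewrite [lambda * _]mulrC divff// mulf_neq0.
by rewrite -powRrM divff// powRr1// ltW.
Qed.

End entropy.

(** * Cubes, Lebesgue measurability and integrability of a power decay *)

Section cubes.
Context {R : realType} {d : nat}.
Local Open Scope ereal_scope.

Lemma borel_measurable_lebesgue (A : set 'rV[R]_d) :
  measurable A -> measurable (A : set (lebesgue_rV_type R d)).
Proof. by move=> mA; apply: sub_caratheodory; exact: sub_sigma_algebra. Qed.

Lemma measurable_coord_lebesgue (i : 'I_d) :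
  measurable_fun [set: lebesgue_rV_type R d] (fun v : 'rV[R]_d => v ord0 i).
Proof.
move=> _ Y mY; rewrite setTI; apply: borel_measurable_lebesgue.
by rewrite -[X in measurable X]setTI; exact: measurable_coord.
Qed.

Lemma measurable_euclidean_norm :
  measurable_fun [set: lebesgue_rV_type R d] (@euclidean_norm R d).
Proof.
rewrite /euclidean_norm.
apply: (@measurableT_comp _ _ _ _ _ _ (@Num.sqrt R)).
  by apply: continuous_measurable_fun; exact: sqrt_continuous.
by apply: measurable_sum => i; apply: measurable_funX;
  exact: measurable_coord_lebesgue.
Qed.

Lemma normr_coord_le_euclidean (v : 'rV[R]_d) i :
  (`|v ord0 i| <= euclidean_norm v)%R.
Proof.
rewrite -sqrtr_sqr ler_wsqrtr// (bigD1 i)//= lerDl.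
by apply: sumr_ge0 => j _; exact: sqr_ge0.
Qed.

(** A closed ball of the sup norm, compact and of explicit volume; it stands in for Euclidean balls
    when the space is exhausted. *)
Definition cube (t : R) : set 'rV[R]_d :=
  [set v | forall i, (v ord0 i \in `[- t, t])%R].

Lemma measurable_cube t : measurable (cube t).
Proof.
rewrite (_ : cube t = \bigcap_(i in [set: 'I_d])
    ((fun v : 'rV[R]_d => v ord0 i) @^-1` `[(- t)%R, t])).
  apply: fin_bigcap_measurable => // i _.
  by rewrite -[X in measurable X]setTI; exact: measurable_coord.
by apply/seteqP; split => v /= H i; [move=> _; exact: H|exact: H].
Qed.

Lemma compact_cube t : compact (cube t).
Proof.
have := @rV_compact R d (fun=> `[(- t)%R, t]%classic); apply => i.
exact: segment_compact.
Qed.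

Lemma lebesgue_rV_cube t : (0 <= t)%R ->
  lebesgue_rV R d (cube t) = ((t *+ 2) ^+ d)%:E.
Proof.
move=> t0; rewrite /lebesgue_rV /= /completed_measure_extension/=.
rewrite measurable_mu_extE; last exact: measurable_cube.
pose a : 'rV[R]_d := const_mx (- t)%R; pose b : 'rV[R]_d := const_mx t.
have -> : cube t =
    [set v : 'rV[R]_d | forall i, (v ord0 i \in `[a ord0 i, b ord0 i])%R].
  by apply/seteqP; split => v /= H i; have := H i; rewrite !mxE.
apply: etrans (@borel_lebesgue_rV_box R d a b _) _; last first.
  congr (_%:E); under eq_bigr do rewrite !mxE opprK -mulr2n.
  by rewrite prodr_const card_ord.
by move=> i; rewrite !mxE ge0_cp.
Qed.

Lemma cube_pow2_cover (v : 'rV[R]_d) r : (0 < r)%R ->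
  exists n, cube (r * 2 ^+ n)%R v.
Proof.
(* An integer [n > |v| / r] is enough, since [n < 2 ^ n]. *)
move=> r0; exists (Num.bound (euclidean_norm v / r)) => i.
rewrite in_itv/= -ler_norml.
apply: le_trans (normr_coord_le_euclidean v i) _.
rewrite mulrC -ler_pdivrMr//.
have := @archi_boundP _ (euclidean_norm v / r).
rewrite divr_ge0 ?sqrtr_ge0 ?(ltW r0)// => /(_ isT)/ltW/le_trans; apply.
by rewrite -natrX ler_nat ltnW// ltn_expl.
Qed.

(** Integrability on compact sets includes measurability on each cube, and countably many cubes
    cover the space. *)
Lemma L1loc_measurable (f : 'rV[R]_d -> R) : L1loc f ->
  measurable_fun [set: lebesgue_rV_type R d] f.
Proof.
move=> lf.
have -> : [set: lebesgue_rV_type R d] = \bigcup_n cube (1 * 2 ^+ n)%R.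
  apply/seteqP; split => // v _.
  by have [n nv] := cube_pow2_cover v ltr01; exists n.
apply/measurable_fun_bigcup => n.
  by apply: borel_measurable_lebesgue; exact: measurable_cube.
by apply/measurable_EFinP; have /integrableP[] := lf _ (@compact_cube (1 * 2 ^+ n)%R).
Qed.

(* On the dyadic shell between the cubes of half-side r 2^(n-1) and r 2^n, f is
   at most M 2^p 2^(-pn) while the outer cube has volume (2r)^d 2^(dn), so the
   integral is dominated by a geometric series of ratio 2^(-eps). *)
Lemma integral_power_decay_lty (f : 'rV[R]_d -> R) (M r eps : R) :
  measurable_fun [set: lebesgue_rV_type R d] f ->
  (1 <= r)%R -> (0 < eps)%R ->
  (forall y, 0 <= f y <= M)%R ->
  (forall y, r <= euclidean_norm y ->
     f y <= M * euclidean_norm y `^ (- (d%:R + eps)))%R ->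
  \int[lebesgue_rV R d]_y (f y)%:E < +oo.
Proof.
move=> mf r1 eps0 fM fdecay.
have r0 : (0 < r)%R := lt_le_trans ltr01 r1.
have M0 : (0 <= M)%R.
  by have /andP[f0 fM0] := fM 0%R; exact: le_trans f0 fM0.
set p := (d%:R + eps)%R in fdecay.
have p0 : (0 < p)%R by rewrite ltr_wpDl.
pose q := (2 `^ (- p))%R : R.
have q0 : (0 < q)%R by rewrite powR_gt0.
have q1 : (q <= 1)%R.
  by rewrite -(powRr0 2) ler_powR ?ler1n// oppr_le0 ltW.
pose B n := cube (r * 2 ^+ n)%R.
(* The factor [1 / q = 2 ^ p] pays for an index shift: a point outside the cube of index [n - 1] has
   norm at least [2 ^ (n - 1)], which gives [q ^ (n - 1)]. *)
pose a n := (M / q * q ^+ n)%R.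
have a0 n : (0 <= a n)%R by rewrite mulr_ge0 ?exprn_ge0 ?divr_ge0// ltW.
have mB n : measurable (B n : set (lebesgue_rV_type R d)).
  by apply: borel_measurable_lebesgue; exact: measurable_cube.
have m1 n : measurable_fun [set: lebesgue_rV_type R d]
    (fun y => (\1_(B n) y)%:E : \bar R).
  apply/measurable_EFinP.
  exact: (@measurable_indic _ (lebesgue_rV_type R d) R setT (B n) (mB n)).
have mterm n : measurable_fun [set: lebesgue_rV_type R d]
    (fun y => (a n)%:E * (\1_(B n) y)%:E).
  by apply: emeasurable_funM => //; exact: m1.
(* Whole cubes replace the shells in the majorant: all terms are nonnegative, and that of the first
   cube containing [y] already dominates [f y]. *)
apply: (@le_lt_trans _ _ (\int[lebesgue_rV R d]_y
    \sum_(0 <= n <oo) ((a n)%:E * (\1_(B n) y)%:E))).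
  apply: ge0_le_integral => //.
  - by move=> y _; rewrite lee_fin; have /andP[] := fM y.
  - exact/measurable_EFinP.
  - apply: ge0_emeasurable_sum => // n y _ _.
    by rewrite mule_ge0// lee_fin.
  - move=> y _.
    have [n Bn nB] : exists2 n, B n y & forall k, (k < n)%N -> ~ B k y.
      have ex : exists n, `[< B n y >].
        by have [n ?] := cube_pow2_cover y r0; exists n; exact/asboolP.
      exists (ex_minn ex); first by case: ex_minnP => n /asboolP.
      move=> k; case: ex_minnP => n _ nmin kn /asboolP /nmin.
      by rewrite leqNgt kn.
    apply: (@le_trans _ _ (\sum_(0 <= k < n.+1) ((a k)%:E * (\1_(B k) y)%:E))).
      rewrite big_nat_recr//= (_ : \1_(B n) y = 1%R); last first.
        by rewrite indicE mem_set.
      rewrite mule1; apply: (@le_trans _ _ (a n)%:E); last first.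
        by rewrite leeDr// sume_ge0// => k _; rewrite mule_ge0// lee_fin.
      (* In the innermost cube, [a 0 = M / q >= M] because [q <= 1]. *)
      rewrite lee_fin /a; case: n Bn nB => [|n] Bn nB.
        rewrite expr0 mulr1; have /andP[_ /le_trans] := fM y; apply.
        by rewrite ler_pdivlMr// ler_piMr.
      have {}nB : ~ cube (r * 2 ^+ n)%R y by exact: nB.
      (* A point of norm below [r * 2 ^ n] would lie in the previous cube. *)
      have yn : (2 ^+ n <= r * 2 ^+ n <= euclidean_norm y)%R.
        rewrite ler_peMl ?exprn_ge0//=.
        rewrite leNgt; apply/negP => yn; apply: nB => i.
        rewrite in_itv/= -ler_norml.
        exact: le_trans (normr_coord_le_euclidean y i) (ltW yn).
      have /andP[yn1 yn2] := yn.
      have n0 : (0 < 2 ^+ n :> R)%R by rewrite exprn_gt0.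
      have ry : (r <= euclidean_norm y)%R.
        by apply: le_trans yn2; rewrite ler_peMr ?(ltW r0)// exprn_ege1// ler1n.
      apply: le_trans (fdecay _ ry) _.
      rewrite exprS mulrA divfK ?gt_eqF// ler_wpM2l//.
      rewrite /q -powR_mulrn ?powR_ge0// -powRrM mulrC powRrM powR_mulrn//.
      rewrite !powRN lef_pV2 ?posrE ?powR_gt0//; last first.
        exact: lt_le_trans r0 ry.
      apply: ge0_ler_powR; rewrite ?nnegrE ?(ltW p0) ?(ltW n0)//.
      - exact: sqrtr_ge0.
      - exact: le_trans yn1 yn2.
    by apply: nneseries_lim_ge => k _ _; rewrite mule_ge0// lee_fin.
rewrite integral_nneseries//; last first.
  by move=> n y _; rewrite mule_ge0// lee_fin.
(* Coefficient times volume of the cube of index [n] is [c * s ^ n]; here [s = 2 ^ (- eps)], since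
   the volume factor [2 ^ d] cancels the [d] in [p]. *)
pose c := (M / q * (r *+ 2) ^+ d)%R.
pose s := (q * 2 ^+ d)%R.
have s0 : (0 <= s)%R by rewrite mulr_ge0 ?exprn_ge0// ltW.
have s1 : (s < 1)%R.
  rewrite /s /q -powR_mulrn// -powRD ?pnatr_eq0 ?implybT// /p opprD addrAC addNr add0r.
  rewrite powRN invf_lt1 ?powR_gt0//.
  have : (1 `^ eps < 2 `^ eps :> R)%R.
    by rewrite gt0_ltr_powR ?nnegrE// ltr1n.
  by rewrite powR1.
have intE n : \int[lebesgue_rV R d]_y ((a n)%:E * (\1_(B n) y)%:E) =
    (c * s ^+ n)%:E.
  rewrite ge0_integralZl_EFin//.
  rewrite integral_indic// setIT lebesgue_rV_cube ?mulr_ge0 ?exprn_ge0 ?(ltW r0)//.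
  rewrite -EFinM; congr (_%:E); rewrite /a /c /s.
  rewrite -mulrnAl !exprMn -!exprM mulnC.
  by rewrite -!mulrA; congr (_ * (_ * _))%R; rewrite mulrCA.
under eq_eseriesr do rewrite intE.
have cs : cvgn (series (geometric c s)).
  by apply: is_cvg_geometric_series; rewrite ger0_norm.
rewrite (_ : (fun n => \sum_(0 <= k < n) _) = EFin \o series (geometric c s)).
  by rewrite EFin_lim// ltry.
by apply/funext => n; rewrite /= sumEFin.
Qed.

End cubes.

(** * Decay of [U], its [L^k] norms and its second moment *)

Section decay.
Context {R : realType} {d : nat}.
Variables lambda eta m : R.
Hypotheses (hlambda : 0 < lambda) (heta : 0 < eta) (hm : 1 < m).
Variable Psi : 'rV[R]_d -> R.
Hypotheses (Psi0 : forall y, 0 <= Psi y) (lPsi : L1loc Psi).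
Variable C : R.

Let A := expR ((eta * m / (m - 1) + C) / lambda).
(** Typing the domain as [lebesgue_rV_type] makes measurability refer to the completed
    sigma-algebra. *)
Let V : lebesgue_rV_type R d -> R := U lambda eta m Psi C.

Let A_ge0 : 0 <= A. Proof. exact: expR_ge0. Qed.

(** [h_inv] is monotone, hence Borel, and [Psi] is Lebesgue measurable by local integrability. *)
Lemma measurable_U : measurable_fun [set: lebesgue_rV_type R d]
  (U lambda eta m Psi C : lebesgue_rV_type R d -> R).
Proof.
apply: (@measurableT_comp _ _ _ _ _ _ (h_inv lambda eta m)).
  by apply: nondecreasing_measurable => // x y; exact: h_inv_nondecreasing.
by apply: measurable_funB => //; exact: L1loc_measurable.
Qed.

Let V_ge0 y : 0 <= V y.
Proof. by have [/ltW] := h_invP hlambda heta hm (C - Psi y). Qed.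

Let V_le_expR y : V y <= A * expR (- (Psi y / lambda)).
Proof.
apply: le_trans (h_inv_le_expR hlambda heta hm _) _.
by rewrite /A -expRD ler_expR addrA mulrDl mulNr.
Qed.

Let V_le y : V y <= A.
Proof.
apply: le_trans (V_le_expR y) _.
rewrite ler_piMr// -[leRHS]expR0 ler_expR oppr_le0 divr_ge0//.
exact: ltW.
Qed.

(** The exponent [s] is left free: [s = d] serves the [L^k] norms and [s = d + 2] the second
    moment. *)
Let V_decay (r s delta : R) : 0 < r -> (forall y : 'rV[R]_d, r <= euclidean_norm y ->
    (lambda * s + delta) * ln (euclidean_norm y) <= Psi y) ->
  forall y : 'rV[R]_d, r <= euclidean_norm y ->
    V y <= A * euclidean_norm y `^ (- (s + delta / lambda)).
Proof.
move=> r0 decay y ry; apply: le_trans (V_le_expR y) _.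
rewrite ler_wpM2l// /powR gt_eqF ?(lt_le_trans r0 ry)// ler_expR.
rewrite mulNr lerN2 ler_pdivlMr//; apply: le_trans (decay _ ry).
rewrite le_eqVlt; apply/orP; left; apply/eqP; field.
by rewrite gt_eqF.
Qed.

(** For [k >= 1] and [|y| >= 1], taking [k]-th powers only speeds up the decay, so [V ^ k] meets the
    integrability criterion with bound [A ^ k]. *)
Lemma U_Lfun (r delta : R) : 0 < r -> 0 < delta ->
  (forall y : 'rV[R]_d, r <= euclidean_norm y ->
    (lambda * d%:R + delta) * ln (euclidean_norm y) <= Psi y) ->
  forall k : R, 1 <= k -> V \in Lfun (lebesgue_rV R d) k%:E.
Proof.
move=> r0 delta0 decay k k1.
have k0 : 0 <= k := le_trans ler01 k1.
have mV : measurable_fun setT V by exact: measurable_U.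
rewrite inE; apply/andP; split; rewrite inE//= /finite_norm.
(* The norm is finite once its [k]-th power, the integral of [V ^ k], is finite. *)
apply: (@lty_poweRy _ _ k); first by rewrite gt_eqF// (lt_le_trans ltr01).
rewrite poweR_Lnorm; last by rewrite gt_eqF// (lt_le_trans ltr01).
under eq_integral => y _ do rewrite /= ger0_norm//.
apply: (@integral_power_decay_lty _ _ (fun y => V y `^ k) (A `^ k)
  (Num.max r 1) (delta / lambda)).
- exact: (measurableT_comp (measurable_powR _)).
- by rewrite le_max lexx orbT.
- by rewrite divr_gt0.
- move=> y; rewrite powR_ge0/=.
  by apply: ge0_ler_powR; rewrite ?nnegrE.
- move=> y; rewrite ge_max => /andP[ry y1].
  have y0 : 0 <= euclidean_norm y := le_trans ler01 y1.
  have p0 : 0 <= d%:R + delta / lambda by rewrite addr_ge0// divr_ge0 ?ltW.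
  apply: (@le_trans _ _ ((A * euclidean_norm y `^ (- (d%:R + delta / lambda))) `^ k)).
    apply: ge0_ler_powR; rewrite ?nnegrE ?mulr_ge0 ?powR_ge0//.
    exact: V_decay decay _ _.
  rewrite powRM ?powR_ge0// ler_wpM2l ?powR_ge0// -powRrM ler_powR//.
  by rewrite mulNr lerN2 ler_peMr.
Qed.

(** Two of the powers of decay absorb the factor [|y| ^ 2], leaving the integrable rate
    [d + delta / lambda]. *)
Lemma U_second_moment (r delta : R) : 0 < r -> 0 < delta ->
  (forall y : 'rV[R]_d, r <= euclidean_norm y ->
    (lambda * (d%:R + 2) + delta) * ln (euclidean_norm y) <= Psi y) ->
  (\int[lebesgue_rV R d]_y ((euclidean_norm y ^+ 2 * V y)%:E) < +oo)%E.
Proof.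
move=> r0 delta0 decay.
pose r' := Num.max r 1.
have r'1 : 1 <= r' by rewrite le_max lexx orbT.
have A_le : A <= r' ^+ 2 * A by rewrite ler_peMl// exprn_ege1.
have eps0 : 0 < delta / lambda by rewrite divr_gt0.
have moment_decay (y : 'rV[R]_d) : r' <= euclidean_norm y ->
    euclidean_norm y ^+ 2 * V y <=
    A * euclidean_norm y `^ (- (d%:R + delta / lambda)).
  rewrite ge_max => /andP[ry y1].
  have y0 : 0 < euclidean_norm y := lt_le_trans ltr01 y1.
  apply: (@le_trans _ _ (euclidean_norm y ^+ 2 *
      (A * euclidean_norm y `^ (- (d%:R + 2 + delta / lambda))))).
    by rewrite ler_wpM2l ?sqr_ge0//; exact: V_decay decay _ _.
  rewrite mulrCA ler_wpM2l// -powR_mulrn ?(ltW y0)//.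
  rewrite -powRD; last by rewrite (gt_eqF y0) implybT.
  by rewrite [X in _ `^ X](_ : _ = - (d%:R + delta / lambda))//; ring.
(* The bound [r' ^ 2 * A] serves both regions: within radius [r'], [|y| ^ 2 <= r' ^ 2] and
   [V y <= A]; beyond it, the decay gives at most [A <= r' ^ 2 * A]. *)
apply: (@integral_power_decay_lty _ _
  (fun y => euclidean_norm y ^+ 2 * V y) (r' ^+ 2 * A) r' (delta / lambda)) => //.
- apply: measurable_funM; last exact: measurable_U.
  by apply: measurable_funX; exact: measurable_euclidean_norm.
- move=> y; rewrite mulr_ge0 ?sqr_ge0//=.
  have [yr|ry] := leP (euclidean_norm y) r'.
    rewrite ler_pM ?sqr_ge0// ler_pXn2r// ?nnegrE ?sqrtr_ge0//.
    exact: le_trans r'1.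
  apply: le_trans (moment_decay _ (ltW ry)) _; apply: le_trans A_le.
  rewrite ler_piMr// -[leRHS](powRr0 (euclidean_norm y)) ler_powR//.
    exact: le_trans r'1 (ltW ry).
  by rewrite oppr_le0 addr_ge0// (ltW eps0).
- move=> y /moment_decay/le_trans; apply.
  by rewrite ler_wpM2r ?powR_ge0.
Qed.

End decay.

Theorem lemma6p1 (R : realType) (d : nat) (hd : (0 < d)%N)
    (lambda eta m : R) (hlambda : 0 < lambda) (heta : 0 < eta) (hm : 1 < m)
    (Psi : 'rV[R]_d -> R) (hPsi0 : forall y, 0 <= Psi y)
    (hPsi : W11loc Psi) (C : R) :
  [/\ unique
        (fun rho : 'rV[R]_d -> R =>
           (forall y, 0 < rho y) /\
           (forall y, lambda * ln (rho y) + eta * m / (m - 1) * rho y `^ (m - 1)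
                      = (eta * m / (m - 1) + C) - Psi y))
        (U lambda eta m Psi C),
      (forall y, U lambda eta m Psi C y =
         (lambda / (eta * m) *
          lambertW0 (eta * m / lambda *
            expR (- ((m - 1) / lambda) *
                  (Psi y - (eta * m / (m - 1) + C))))) `^ (m - 1)^-1),
      ((exists r delta : R, [/\ 0 < r, 0 < delta &
          forall y, r <= euclidean_norm y ->
            (lambda * d%:R + delta) * ln (euclidean_norm y) <= Psi y]) ->
        forall k : R, 1 <= k ->
          (U lambda eta m Psi C : lebesgue_rV_type R d -> R)
            \in Lfun (lebesgue_rV R d) k%:E)
    & ((exists r delta : R, [/\ 0 < r, 0 < delta &
          forall y, r <= euclidean_norm y ->
            (lambda * (d%:R + 2) + delta) * ln (euclidean_norm y) <= Psi y]) ->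
        (forall k : R, 1 <= k ->
          (U lambda eta m Psi C : lebesgue_rV_type R d -> R)
            \in Lfun (lebesgue_rV R d) k%:E) /\
        (\int[lebesgue_rV R d]_y
           ((euclidean_norm y ^+ 2 * U lambda eta m Psi C y)%:E) < +oo)%E)].
Proof.
have [lPsi _] := hPsi; have mU := measurable_U hlambda heta hm lPsi C.
split.
- split; first split.
  + by move=> y; have [] := h_invP hlambda heta hm (C - Psi y).
  + move=> y; have [_ hU] := h_invP hlambda heta hm (C - Psi y).
    by rewrite -addrA -hU /h /U; ring.
  + move=> rho [rho0 rhoE]; apply/funext => y; rewrite /U.
    (* The equation for [rho] says [h (rho y) = C - Psi y], and [hK] recovers [rho y] from it. *)
    rewrite -[RHS](hK hlambda heta hm (rho0 y)); congr h_inv.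
    by rewrite /h mulrBr mulr1 addrA rhoE; ring.
- move=> y; rewrite /U (h_inv_lambert hlambda heta hm).
  by congr ((_ * lambertW0 (_ * expR _)) `^ _); ring.
- move=> [r [delta [r0 delta0 decay]]] k k1.
  exact: (U_Lfun hlambda heta hm hPsi0 lPsi C r0 delta0 decay).
- move=> [r [delta [r0 delta0 decay]]]; split.
    move=> k k1.
    (* The stronger growth condition is the weaker one with [lambda * 2 + delta] in place of
       [delta], at the same radius. *)
    apply: (U_Lfun hlambda heta hm hPsi0 lPsi C r0 _ _ k1 (delta := lambda * 2 + delta)).
      by rewrite addr_gt0// mulr_gt0.
    by move=> y /decay; rewrite mulrDr addrA.
  exact: (U_second_moment hlambda heta hm hPsi0 lPsi C r0 delta0 decay).
Qed.
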